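(* Let $m,q,p$ be positive integers. Let $A_0\in\mathbb{R}^{m\times q}$ and let $Q_0\in\mathbb{R}^{m\times q}$, $R_0\in\mathbb{R}^{q\times q}$ be a QR decomposition $Q_0R_0=A_0$. Let $A_1\in\mathbb{R}^{m\times p}$, and let $R\in\mathbb{R}^{p\times p}$ be given by the Cholesky factorization $$R^{T}R=(A_1-Q_0Q_0^{T}A_1)^{T}(A_1-Q_0Q_0^{T}A_1)=A_1^{T}A_1-A_1^{T}Q_0Q_0^{T}A_1 ,$$ where $R$ is upper triangular and invertible. Then the matrices $$\hat Q=\begin{bmatrix}Q_0 & (A_1-Q_0Q_0^{T}A_1)R^{-1}\end{bmatrix}\in\mathbb{R}^{m\times(q+p)}$$ and $$\hat R=\begin{bmatrix}R_0 & Q_0^{T}A_1\\ 0 & R\end{bmatrix}\in\mathbb{R}^{(q+p)\times(q+p)}$$ form a QR decomposition of $A=\begin{bmatrix}A_0 & A_1\end{bmatrix}\in\mathbb{R}^{m\times(q+p)}$.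
   Context: A (thin) QR decomposition of a matrix $M\in\mathbb{R}^{m\times k}$ is a pair $Q\in\mathbb{R}^{m\times k}$, $S\in\mathbb{R}^{k\times k}$ with $M=QS$, where $Q$ has orthonormal columns, i.e. $Q^{T}Q=I_k$, and $S$ is upper triangular ($S$ is not required to be invertible or to have positive diagonal). A Cholesky factorization of a symmetric positive definite matrix $X\in\mathbb{R}^{p\times p}$ is a factorization $X=R^{T}R$ with $R\in\mathbb{R}^{p\times p}$ upper triangular with positive diagonal entries (hence invertible). Exact arithmetic is assumed. *)

(* Defs.v *)
From mathcomp Require Import all_boot all_order all_algebra.
From mathcomp Require Import reals.

Set Implicit Arguments.
Unset Strict Implicit.
Unset Printing Implicit Defensive.

Import Order.TTheory GRing.Theory Num.Theory.
Local Open Scope ring_scope.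

(* [is_trig_mx] is lower triangularity (A i j = 0 for i < j), hence the
   transpose. *)
Definition upper_triangular (F : realType) (n : nat) (A : 'M[F]_n) : Prop :=
  is_trig_mx A^T.

(* Thin QR decomposition: nothing is asked of the diagonal of S. *)
Definition is_QR (F : realType) (m k : nat)
    (M Q : 'M[F]_(m, k)) (S : 'M[F]_k) : Prop :=
  [/\ M = Q *m S, Q^T *m Q = 1%:M & upper_triangular S].

(* The vector x is a column; x^T *m X *m x is a 1 x 1 matrix. *)
Definition sym_posdef (F : realType) (p : nat) (X : 'M[F]_p) : Prop :=
  X^T = X /\ (forall x : 'cV[F]_p, x != 0 -> 0 < (x^T *m X *m x) 0 0).

(* Cholesky factorizations are those of symmetric positive definite matrices;
   [sym_posdef X] already follows from the other conditions. *)
Definition is_cholesky (F : realType) (p : nat) (X R : 'M[F]_p) : Prop :=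
  [/\ sym_posdef X, X = R^T *m R, upper_triangular R & forall i, 0 < R i i].

(* Main.v *)
Require Import Defs.
From mathcomp Require Import all_boot all_order all_algebra.
From mathcomp Require Import reals.

Import Order.TTheory GRing.Theory Num.Theory.
Local Open Scope ring_scope.

(** This is one step of block Gram-Schmidt. The residual [W = A1 - Q0 Q0^T A1] is [A1] minus its
    projection onto the column space of [Q0], so [Q0^T W = 0] ([tr_mul_residual]). Multiplying [W]
    by the inverse of its Cholesky factor keeps this orthogonality and turns the Gram matrix
    [W^T W = R^T R] into the identity. The product of the two block factors restores [A1] as
    projection plus residual. *)

Lemma tr_mul_residual (F : comNzRingType) (m q p : nat)
    (Q : 'M[F]_(m, q)) (A : 'M[F]_(m, p)) :
  Q^T *m Q = 1%:M -> Q^T *m (A - Q *m Q^T *m A) = 0.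
Proof. by move=> QTQ; rewrite mulmxBr !mulmxA QTQ mul1mx subrr. Qed.

(** Expanding only the left factor suffices: its projection part ends in [Q^T], which annihilates
    the residual on the right. *)
Lemma gram_residual (F : comNzRingType) (m q p : nat)
    (Q : 'M[F]_(m, q)) (A : 'M[F]_(m, p)) :
  Q^T *m Q = 1%:M ->
  (A - Q *m Q^T *m A)^T *m (A - Q *m Q^T *m A)
    = A^T *m A - A^T *m Q *m Q^T *m A.
Proof.
move=> QTQ; have -> : (A - Q *m Q^T *m A)^T = A^T - A^T *m Q *m Q^T.
  by rewrite [LHS]raddfB /= !trmx_mul trmxK mulmxA.
rewrite mulmxBl -[_ *m Q^T *m (_ - _)]mulmxA tr_mul_residual // mulmx0 subr0.
by rewrite mulmxBr !mulmxA.
Qed.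

(** The determinant, taken on the transpose, is the product of the diagonal entries. *)
Lemma upper_triangular_unitmx (F : realType) (n : nat) (A : 'M[F]_n) :
  upper_triangular A -> (forall i, A i i != 0) -> A \in unitmx.
Proof.
move=> trigA A_neq0; rewrite unitmxE -det_tr det_trig // unitfE.
by apply/prodf_neq0 => i _; rewrite mxE.
Qed.

Lemma upper_triangular_block (F : realType) (m n : nat)
    (A : 'M[F]_m) (B : 'M[F]_(m, n)) (D : 'M[F]_n) :
  upper_triangular A -> upper_triangular D ->
  upper_triangular (block_mx A B 0 D).
Proof.
move=> trigA trigD; rewrite /upper_triangular tr_block_mx is_trig_block_mx //.
by apply/and3P; split; rewrite // trmx0.
Qed.

Theorem proposition2p1 (F : realType) (m q p : nat)
  (hm : (0 < m)%N) (hq : (0 < q)%N) (hp : (0 < p)%N)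
  (A0 Q0 : 'M[F]_(m, q)) (R0 : 'M[F]_q)
  (hQR0 : is_QR A0 Q0 R0)
  (A1 : 'M[F]_(m, p)) (R : 'M[F]_p)
  (hR : is_cholesky
          ((A1 - Q0 *m Q0^T *m A1)^T *m (A1 - Q0 *m Q0^T *m A1)) R) :
  [/\ (A1 - Q0 *m Q0^T *m A1)^T *m (A1 - Q0 *m Q0^T *m A1)
        = A1^T *m A1 - A1^T *m Q0 *m Q0^T *m A1,
      R \in unitmx
    & is_QR (row_mx A0 A1)
            (row_mx Q0 ((A1 - Q0 *m Q0^T *m A1) *m invmx R))
            (block_mx R0 (Q0^T *m A1) 0 R)].
Proof.
case: hQR0 => A0E QTQ trigR0; case: hR => _ WTW trigR R_gt0.
have R_unit : R \in unitmx.
  by apply: upper_triangular_unitmx => // i; rewrite gt_eqF.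
have QTW := tr_mul_residual _ _ _ _ _ A1 QTQ.
split=> //; first exact: gram_residual.
split; last exact: upper_triangular_block.
(* In the second block column [R] cancels its inverse, leaving [Q0 Q0^T A1 + W = A1]. *)
- rewrite mul_row_block mulmx0 addr0 -A0E mulmxKV // mulmxA.
  by rewrite addrC subrK.
- set W := A1 - _ in WTW QTW *.
  have WTQ : W^T *m Q0 = 0 by rewrite -[LHS]trmxK trmx_mul trmxK QTW trmx0.
  (* The off-diagonal blocks of the Gram matrix vanish by [QTW] and [WTQ]; the last diagonal block
     is [R^-T (R^T R) R^-1 = (R R^-1)^T]. *)
  rewrite tr_row_mx mul_col_row QTQ trmx_mul mulmxA QTW mul0mx.
  rewrite -!mulmxA WTQ mulmx0 [W^T *m _]mulmxA WTW mulmxK //.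
  by rewrite -trmx_mul mulmxV // trmx1 -scalar_mx_block.
Qed.
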